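(* Let $s$ and $r\le d\le n$ be positive integers and let $\epsilon,\delta\in(0,1)$. Let $\mu>0$ and suppose that the positive integer $m$ is such that the distribution of $1$-hashing matrices $S\in\mathbb{R}^{m\times ns}$ is an $(\epsilon,\delta)$-oblivious subspace embedding for any matrix $B\in\mathbb{R}^{ns\times d}$ with rank $r$ and $\mu(B)\le\mu$; that is, for every such fixed $B$, a random $1$-hashing matrix $S\in\mathbb{R}^{m\times ns}$ is an $\epsilon$-subspace embedding for $B$ with probability at least $1-\delta$. Then the distribution of $s$-hashing variant matrices $T\in\mathbb{R}^{m\times n}$ is an $(\epsilon,\delta)$-oblivious subspace embedding for any matrix $A\in\mathbb{R}^{n\times d}$ with rank $r$ and $\mu(A)\le\mu\sqrt{s}$; that is, for every such fixed $A$, a random $s$-hashing variant matrix $T\in\mathbb{R}^{m\times n}$ is an $\epsilon$-subspace embedding for $A$ with probability at least $1-\delta$.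
   Context: Compact SVD: a matrix $A\in\mathbb{R}^{n\times d}$ of rank $r$ is written $A=U\Sigma V^T$ with $U\in\mathbb{R}^{n\times r}$, $V\in\mathbb{R}^{d\times r}$ having orthonormal columns and $\Sigma\in\mathbb{R}^{r\times r}$ diagonal with strictly positive diagonal entries. Coherence: $\mu(A)=\max_{1\le i\le n}\|U_i\|_2$, where $U_i$ is the $i$th row of $U$ (analogously for matrices with $ns$ rows). $\epsilon$-subspace embedding: $S\in\mathbb{R}^{m\times n}$ is an $\epsilon$-subspace embedding for $B\in\mathbb{R}^{n\times k}$ if $(1-\epsilon)\|y\|_2^2\le\|Sy\|_2^2\le(1+\epsilon)\|y\|_2^2$ for all $y\in\{Bz: z\in\mathbb{R}^k\}$. $1$-hashing matrix: a random matrix $S\in\mathbb{R}^{m\times N}$ such that, independently for each column $j\in\{1,\dots,N\}$, one samples $i\in\{1,\dots,m\}$ uniformly at random and sets $S_{ij}=\pm1$ (independent uniformly random sign), all other entries of the column being $0$. $s$-hashing variant matrix: a random matrix $T\in\mathbb{R}^{m\times n}$ (starting from zero) such that, independently for each column $j\in\{1,\dots,n\}$, one samples with replacement $i_1,\dots,i_s\in\{1,\dots,m\}$ uniformly at random and adds $\pm1/\sqrt{s}$ (independent uniformly random signs) to $T_{i_kj}$ for $k=1,\dots,s$. *)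

(* Defs.v *)
From HB Require Import structures.
From mathcomp Require Import all_boot all_order all_algebra.
From mathcomp Require Import boolp classical_sets reals.
Set Implicit Arguments.
Unset Strict Implicit.
Unset Printing Implicit Defensive.
Import Order.TTheory GRing.Theory Num.Theory.
Local Open Scope ring_scope.

Definition l2norm (R : realType) (k : nat) (v : 'cV[R]_k) : R :=
  Num.sqrt (\sum_(i < k) v i 0 ^+ 2).

Definition compact_svd (R : realType) (n d : nat) (A : 'M[R]_(n, d))
    (U : 'M[R]_(n, \rank A)) (Sigma : 'M[R]_(\rank A))
    (V : 'M[R]_(d, \rank A)) : Prop :=
  [/\ A = U *m Sigma *m V^T,
      U^T *m U = 1%:M,
      V^T *m V = 1%:M,
      is_diag_mx Sigma
    & forall i, 0 < Sigma i i].

Definition max_row_norm (R : realType) (n r : nat) (U : 'M[R]_(n, r)) : R :=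
  \big[Num.max/0]_(i < n) l2norm (row i U)^T.

(* Every real matrix has a compact SVD, but its factor U is not unique, so
   coherence picks one by choice; by coherenceE the value does not depend on
   the pick. *)
Definition svd_left (R : realType) (n d : nat) (A : 'M[R]_(n, d)) :
    'M[R]_(n, \rank A) :=
  xget 0 [set U | exists Sigma V, compact_svd U Sigma V]%classic.

Definition coherence (R : realType) (n d : nat) (A : 'M[R]_(n, d)) : R :=
  max_row_norm (svd_left A).

Lemma compact_svd_gram (R : realType) (n d : nat) (A : 'M[R]_(n, d))
    (U1 U2 : 'M[R]_(n, \rank A)) (S1 S2 : 'M[R]_(\rank A))
    (V1 V2 : 'M[R]_(d, \rank A)) :
  compact_svd U1 S1 V1 -> compact_svd U2 S2 V2 -> U1 *m U1^T = U2 *m U2^T.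
Proof.
move=> [E1 oU1 oV1 dS1 pS1] [E2 oU2 _ _ _].
have S1u : S1 \in unitmx.
  rewrite unitmxE det_trig; last exact: is_diag_mx_is_trig.
  by rewrite unitfE; apply/prodf_neq0 => i _; rewrite gt_eqF.
pose M := S2 *m V2^T *m V1 *m invmx S1.
have EU : U1 = U2 *m M.
  rewrite /M !mulmxA -E2 [X in _ = X *m _ *m _]E1 -(mulmxA (U1 *m S1)) oV1.
  by rewrite mulmx1 mulmxK.
have oM : M^T *m M = 1%:M.
  move: oU1; rewrite EU; move: (M) => N.
  by rewrite trmx_mul mulmxA -(mulmxA _ U2^T) oU2 mulmx1.
rewrite EU; move: (M) oM => N oN.
by rewrite trmx_mul mulmxA -(mulmxA U2) (mulmx1C oN) mulmx1.
Qed.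

Lemma coherenceE (R : realType) (n d : nat) (A : 'M[R]_(n, d))
    (U : 'M[R]_(n, \rank A)) (Sigma : 'M[R]_(\rank A))
    (V : 'M[R]_(d, \rank A)) :
  compact_svd U Sigma V -> coherence A = max_row_norm U.
Proof.
move=> svdU; rewrite /coherence /svd_left.
case: xgetP => [W _ [S' [V' svdW]]|noU]; last first.
  by case: (noU U); exists Sigma, V.
apply: eq_bigr => i _; rewrite /l2norm; congr Num.sqrt.
have /matrixP/(_ i i) := compact_svd_gram svdW svdU.
rewrite !mxE => E; rewrite (eq_bigr (fun j => W i j * W^T j i)); last first.
  by move=> j _; rewrite !mxE expr2.
by rewrite E; apply: eq_bigr => j _; rewrite !mxE expr2.
Qed.

Definition subspace_embedding (R : realType) (m n k : nat) (eps : R)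
    (S : 'M[R]_(m, n)) (B : 'M[R]_(n, k)) : Prop :=
  forall y : 'cV[R]_n, (exists z : 'cV[R]_k, y = B *m z) ->
    (1 - eps) * l2norm y ^+ 2 <= l2norm (S *m y) ^+ 2 <=
    (1 + eps) * l2norm y ^+ 2.

Definition Pr (R : realType) (Omega : finType) (p : Omega -> R)
    (E : Omega -> Prop) : R :=
  \sum_(w | `[< E w >]) p w.

(* X is a random matrix on the finite probability space (Omega, p), and C the
   class of matrices the embedding guarantee is for. *)
Definition oblivious_subspace_embedding (R : realType) (Omega : finType)
    (p : Omega -> R) (m n d : nat) (X : Omega -> 'M[R]_(m, n))
    (eps delta : R) (C : set 'M[R]_(n, d)) : Prop :=
  forall B, C B -> 1 - delta <= Pr p (fun w => subspace_embedding eps (X w) B).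

(* Independent draws indexed by I, each a uniform row index in 'I_m together
   with an independent uniform sign bit. *)
Definition draws (I : finType) (m : nat) := {ffun I -> 'I_m * bool}.

(* By independence, the weight of w is the product over the draws of
   1/m (row index) times 1/2 (sign). *)
Definition draws_prob (R : realType) (I : finType) (m : nat)
    (w : draws I m) : R :=
  \prod_(i : I) (m%:R^-1 * 2^-1).

Lemma Pr_draws_total (R : realType) (I : finType) (m : nat) (m_gt0 : (0 < m)%N) :
  Pr (@draws_prob R I m) (fun=> True) = 1.
Proof.
rewrite /Pr (eq_bigl xpredT); last by move=> w; apply/asboolP.
rewrite /draws_prob sumr_const prodr_const card_ffun card_prod card_ord card_bool.
rewrite -[LHS]mulr_natr -invfM -natrM exprVn natrX mulVf //.
by rewrite expf_neq0 // pnatr_eq0 muln_eq0 /= orbF -lt0n.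
Qed.

Definition hashing1 (R : realType) (m N : nat) (w : draws 'I_N m) :
    'M[R]_(m, N) :=
  \matrix_(i, j) (if (w j).1 == i then (-1) ^+ (w j).2 else 0).

(* The draw indexed by (j, k) is the k-th sample for column j. *)
Definition hashing_variant (R : realType) (m n s : nat)
    (w : draws ('I_n * 'I_s)%type m) : 'M[R]_(m, n) :=
  \matrix_(i, j) \sum_(k < s)
    (if (w (j, k)).1 == i then (-1) ^+ (w (j, k)).2 / Num.sqrt s%:R else 0).

(* Main.v *)
Require Import Defs.
From mathcomp Require Import all_boot all_order all_algebra.
From mathcomp Require Import boolp classical_sets reals.
Set Implicit Arguments.
Unset Strict Implicit.
Unset Printing Implicit Defensive.
Import Order.TTheory GRing.Theory Num.Theory.
Local Open Scope ring_scope.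

(** An [s]-hashing variant matrix is a [1]-hashing matrix applied to a
    stretched vector. Let [W] be the matrix with [n * s] rows that repeats each
    coordinate of a vector [s] times and divides by [sqrt s]. Its columns are
    orthonormal, and if the [n * s] columns of a [1]-hashing matrix [S] are
    identified with the [s] samples for each of the [n] columns of [T], then
    [T = S W] draw by draw ([hashing1_spread]). As [W] preserves norms, [T]
    embeds the column space of [A] exactly when [S] embeds that of [W A], and
    the identification of the index sets preserves the uniform law of the
    draws ([Pr_draws_reindex]).

    So it suffices that the hypothesis on [S] covers [B = W A]. The rank is
    unchanged because [W^T W = 1]. For the coherence, a left singular factor of
    [W A] is [W] times one of [A], and each of its rows is a row of the latter
    divided by [sqrt s] ([coherence_spread]). This turns the bound
    [mu * sqrt s] into [mu]. *)

Lemma l2norm_sqr (R : realType) (k : nat) (v : 'cV[R]_k) :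
  l2norm v ^+ 2 = (v^T *m v) 0 0.
Proof.
rewrite sqr_sqrtr; last by apply: sumr_ge0 => i _; rewrite sqr_ge0.
by rewrite mxE; apply: eq_bigr => i _; rewrite mxE expr2.
Qed.

Lemma l2normZ (R : realType) (k : nat) (a : R) (v : 'cV[R]_k) :
  l2norm (a *: v) = `|a| * l2norm v.
Proof.
rewrite /l2norm -sqrtr_sqr -sqrtrM ?sqr_ge0 // mulr_sumr.
by congr Num.sqrt; apply: eq_bigr => i _; rewrite mxE exprMn.
Qed.

Lemma l2norm_sqr_isometry (R : realType) (N n : nat) (W : 'M[R]_(N, n))
    (v : 'cV[R]_n) :
  W^T *m W = 1%:M -> l2norm (W *m v) ^+ 2 = l2norm v ^+ 2.
Proof.
by move=> oW; rewrite !l2norm_sqr trmx_mul mulmxA -(mulmxA _ W^T) oW mulmx1.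
Qed.

Lemma mxrank_isometry (R : realType) (N n d : nat) (W : 'M[R]_(N, n))
    (A : 'M[R]_(n, d)) :
  W^T *m W = 1%:M -> \rank (W *m A) = \rank A.
Proof.
move=> oW; apply/eqP; rewrite eqn_leq mxrankM_maxr /=.
by rewrite -{1}[A]mul1mx -oW -mulmxA mxrankM_maxr.
Qed.

Lemma subspace_embedding_isometry (R : realType) (m N n d : nat) (eps : R)
    (S : 'M[R]_(m, N)) (W : 'M[R]_(N, n)) (A : 'M[R]_(n, d)) :
  W^T *m W = 1%:M ->
  subspace_embedding eps S (W *m A) -> subspace_embedding eps (S *m W) A.
Proof.
move=> oW embS y [z ->].
have := embS (W *m (A *m z)) (ex_intro _ z (mulmxA _ _ _)).
by rewrite (l2norm_sqr_isometry _ oW) mulmxA.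
Qed.

(** The inner dimension [r] is kept apart from [\rank A] so that a
    factorization found for one matrix can be used for another one whose rank
    is equal only propositionally. *)
Lemma coherence_svd (R : realType) (n d r : nat) (A : 'M[R]_(n, d))
    (U : 'M[R]_(n, r)) (Sigma : 'M[R]_r) (V : 'M[R]_(d, r)) :
  \rank A = r -> A = U *m Sigma *m V^T -> U^T *m U = 1%:M ->
  V^T *m V = 1%:M -> is_diag_mx Sigma -> (forall i, 0 < Sigma i i) ->
  coherence A = max_row_norm U.
Proof.
move=> Er; subst r => EA oU oV dS pS.
exact: (@coherenceE _ _ _ _ _ Sigma V).
Qed.

(** Multiplication on the right by [V Sigma^-1] recovers [U] from
    [W A = U Sigma V^T], so the columns of [U] lie in the range of [W]; there
    [W W^T] is the identity, hence [W^T U] is a left singular factor of [A].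
    The first alternative is the default value of the coherence, taken by a
    matrix without a compact SVD. *)
Lemma coherence_isometry (R : realType) (N n d : nat) (W : 'M[R]_(N, n))
    (A : 'M[R]_(n, d)) :
  W^T *m W = 1%:M ->
  coherence (W *m A) = 0 \/
  exists r (U : 'M[R]_(n, r)),
    coherence (W *m A) = max_row_norm (W *m U) /\ coherence A = max_row_norm U.
Proof.
move=> oW; rewrite {1}/coherence /svd_left.
case: xgetP => [U _ [Sigma [V svdU]]|_]; last first.
  left; rewrite /max_row_norm; apply: big1_idem => [|i _]; first exact: maxxx.
  rewrite /l2norm big1 ?sqrtr0 // => j _.
  by rewrite !mxE expr0n.
right; exists (\rank (W *m A)), (W^T *m U).
rewrite (coherenceE svdU).
have [EB oU oV dS pS] := svdU.
have Su : Sigma \in unitmx.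
  rewrite unitmxE det_trig; last exact: is_diag_mx_is_trig.
  by rewrite unitfE; apply/prodf_neq0 => i _; rewrite gt_eqF.
have EU : U = W *m (A *m V *m invmx Sigma).
  rewrite !mulmxA [X in _ = X *m _ *m _]EB -(mulmxA (U *m Sigma)) oV.
  by rewrite mulmx1 mulmxK.
have WWU : W *m (W^T *m U) = U.
  rewrite EU; move: (A *m V *m invmx Sigma) => X.
  by rewrite (mulmxA W^T) oW mul1mx.
split; first by rewrite WWU.
apply: (@coherence_svd _ _ _ _ _ _ Sigma V) => //.
- by rewrite mxrank_isometry.
- by rewrite -!mulmxA [U *m _]mulmxA -EB mulmxA oW mul1mx.
- by rewrite trmx_mul trmxK -mulmxA WWU.
Qed.

(** The matrix [W] that repeats each coordinate [s] times, scaled to be an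
    isometry. The map [g] sends each of the [N] coordinates to the pair (source
    coordinate, number of the copy). *)
Definition spread (R : realType) (N n s : nat) (g : 'I_N -> 'I_n * 'I_s) :
    'M[R]_(N, n) :=
  \matrix_(l, j) (((g l).1 == j)%:R / Num.sqrt s%:R).

Lemma row_spread (R : realType) (N n s r : nat) (g : 'I_N -> 'I_n * 'I_s)
    (U : 'M[R]_(n, r)) (l : 'I_N) :
  row l (spread R g *m U) = (Num.sqrt s%:R)^-1 *: row (g l).1 U.
Proof.
apply/rowP => q; rewrite !mxE (bigD1 (g l).1) //= big1 ?addr0.
  by rewrite !mxE eqxx mul1r.
by move=> j neq; rewrite !mxE eq_sym (negPf neq) !mul0r.
Qed.

Lemma spread_isometry (R : realType) (N n s : nat) (g : 'I_N -> 'I_n * 'I_s) :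
  bijective g -> (0 < s)%N -> (spread R g)^T *m spread R g = 1%:M.
Proof.
move=> [f gK fK] s_gt0; apply/matrixP => i j; rewrite !mxE.
rewrite (reindex f) /=; last by exists g => p _; [exact: fK | exact: gK].
rewrite (eq_bigr (fun p : 'I_n * 'I_s =>
    (p.1 == i)%:R * (p.1 == j)%:R * s%:R^-1)); last first.
  by move=> p _; rewrite !mxE fK mulrACA -invfM -expr2 sqr_sqrtr ?ler0n.
rewrite -(pair_bigA _ (fun a (_ : 'I_s) => (a == i)%:R * (a == j)%:R * s%:R^-1)).
rewrite (bigD1 i) //= [X in _ + X]big1 ?addr0; last first.
  by move=> a /negPf->; apply: big1 => k _; rewrite !mul0r.
rewrite sumr_const card_ord eqxx mul1r -[LHS]mulr_natr -mulrA mulVf ?mulr1 //.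
by rewrite pnatr_eq0 -lt0n.
Qed.

Lemma coherence_spread (R : realType) (N n d s : nat) (g : 'I_N -> 'I_n * 'I_s)
    (A : 'M[R]_(n, d)) (mu : R) :
  bijective g -> (0 < s)%N -> 0 <= mu ->
  coherence A <= mu * Num.sqrt s%:R -> coherence (spread R g *m A) <= mu.
Proof.
move=> g_bij s_gt0 mu_ge0.
have [->//|[r [U [-> ->]]]] := coherence_isometry A (spread_isometry R g_bij s_gt0).
move=> leU; apply: bigmax_le => // l _.
rewrite row_spread linearZ /= l2normZ normfV ger0_norm ?sqrtr_ge0 //.
rewrite mulrC ler_pdivrMr ?sqrtr_gt0 ?ltr0n //.
apply: le_trans leU.
exact: (le_bigmax _ (fun j => l2norm (row j U)^T)).
Qed.

(** Each column of [spread] has its nonzero entries at the [s] coordinates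
    that [g] maps to this column; these select the [s] samples. *)
Lemma hashing1_spread (R : realType) (m N n s : nat) (g : 'I_N -> 'I_n * 'I_s)
    (w : draws ('I_n * 'I_s)%type m) :
  bijective g ->
  hashing1 R [ffun l => w (g l)] *m spread R g = hashing_variant R w.
Proof.
move=> [f gK fK]; apply/matrixP => i j; rewrite !mxE.
rewrite (reindex f) /=; last by exists g => p _; [exact: fK | exact: gK].
pose F a k : R := (if (w (a, k)).1 == i then (-1) ^+ (w (a, k)).2 else 0) *
  ((a == j)%:R / Num.sqrt s%:R).
rewrite (eq_bigr (fun p => F p.1 p.2)); last first.
  by case=> a k _; rewrite !mxE !ffunE fK.
rewrite -(pair_bigA _ F) (bigD1 j) //= [X in _ + X]big1 ?addr0; last first.
  by move=> a /negPf neq; apply: big1 => k _; rewrite /F neq mul0r mulr0.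
by apply: eq_bigr => k _; rewrite /F eqxx mul1r; case: ifP; rewrite ?mul0r.
Qed.

Lemma Pr_draws_reindex (R : realType) (I J : finType) (m : nat) (g : J -> I)
    (E : draws J m -> Prop) :
  bijective g ->
  Pr (@draws_prob R J m) E =
  Pr (@draws_prob R I m) (fun w => E [ffun l => w (g l)]).
Proof.
move=> g_bij; have [f gK fK] := g_bij; rewrite /Pr.
rewrite (reindex (fun w : draws I m => [ffun l => w (g l)] : draws J m)) /=.
  by apply: eq_bigr => w _; rewrite /draws_prob !prodr_const (bij_eq_card g_bij).
exists (fun w : draws J m => [ffun p => w (f p)]) => w _;
  by apply/ffunP => x; rewrite !ffunE ?fK ?gK.
Qed.

Lemma Pr_draws_le (R : realType) (I : finType) (m : nat)
    (E F : draws I m -> Prop) :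
  (forall w, E w -> F w) ->
  Pr (@draws_prob R I m) E <= Pr (@draws_prob R I m) F.
Proof.
move=> EF; rewrite /Pr big_mkcond [leRHS]big_mkcond; apply: ler_sum => w _.
have p_ge0 : 0 <= draws_prob R w.
  by apply: prodr_ge0 => i _; rewrite mulr_ge0 ?invr_ge0 ?ler0n.
by case: asboolP => [/EF Fw|_]; [case: asboolP | case: ifP].
Qed.

Theorem theorem4 (R : realType) (s r d n m : nat) (eps delta mu : R)
    (s_gt0 : (0 < s)%N) (r_gt0 : (0 < r)%N) (le_rd : (r <= d)%N)
    (le_dn : (d <= n)%N) (m_gt0 : (0 < m)%N)
    (eps01 : 0 < eps < 1) (delta01 : 0 < delta < 1) (mu_gt0 : 0 < mu)
    (hash1_ose : oblivious_subspace_embedding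
       (@draws_prob R 'I_(n * s) m) (@hashing1 R m (n * s)) eps delta
       [set B : 'M[R]_(n * s, d) | \rank B = r /\ coherence B <= mu]%classic) :
  oblivious_subspace_embedding
    (@draws_prob R ('I_n * 'I_s)%type m) (@hashing_variant R m n s) eps delta
    [set A : 'M[R]_(n, d) |
      \rank A = r /\ coherence A <= mu * Num.sqrt s%:R]%classic.
Proof.
move=> A [rA cA].
have [g fK gK] := curry_mxvec_bij n s.
have g_bij : bijective g.
  by exists (uncurry (@mxvec_index n s)) => x; [apply: gK | apply: fK].
have oW := spread_isometry R g_bij s_gt0.
have CB : \rank (spread R g *m A) = r /\ coherence (spread R g *m A) <= mu.
  rewrite mxrank_isometry //; split=> //.
  by apply: coherence_spread cA; rewrite // ltW.
apply: le_trans (hash1_ose _ CB) _.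
rewrite (Pr_draws_reindex _ _ g_bij); apply: Pr_draws_le => w.
by rewrite -(hashing1_spread _ _ g_bij); apply: subspace_embedding_isometry.
Qed.
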